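(* Let $K$ be a field and $n>0$ an integer. For every linear mapping $E:K^n\to K^n$ there exist a straight-line program $P$ consisting of at most $2n-1$ linear assignments of the components of $X=(x_1,\dots,x_n)$ which computes the transformation $X:=E(X)$, and a matrix $M\in M_{n,n}(K)$, such that the first $n$ instructions of $P$ are, in order, $x_i:=\sum_{j=1}^n M_{i,j}x_j$ for $i=1,2,\dots,n$ (i.e. the first $n$ steps of $P$ form the sequential program $M^\pi$).
   Context: A straight-line program of linear assignments of the components of $X=(x_1,\dots,x_n)\in K^n$ is a finite sequence of instructions, each of the form $x_i:=\sum_{j=1}^n c_j x_j$ with $c_j\in K$, executed in the given order and in place on the single vector $X$ (each instruction uses the current values of the components and overwrites the component $x_i$). Such a program computes $X:=E(X)$ if, for every initial vector $X\in K^n$, the vector obtained after executing all instructions equals $E$ applied to the initial vector. For $M\in M_{n,n}(K)$, $M_{i,j}$ denotes the $(i,j)$ entry, and $M^\pi$ is the program ''for $i$ from $1$ to $n$ do $x_i:=\sum_{j=1}^n M_{i,j}x_j$'' executed in place on $X$. *)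

(* Defs.v *)
From HB Require Import structures.
From mathcomp Require Import all_boot all_order all_algebra.

Set Implicit Arguments.
Unset Strict Implicit.
Unset Printing Implicit Defensive.

Import GRing.Theory.
Local Open Scope ring_scope.

(* The instruction x_i := \sum_j c_j x_j is the pair of its target index i and
   its coefficient row c; vectors of K^n are column vectors. *)
Definition instruction (K : fieldType) (n : nat) : Type := ('I_n * 'rV[K]_n)%type.

Definition program (K : fieldType) (n : nat) : Type := seq (instruction K n).

Definition exec_instr (K : fieldType) (n : nat)
    (X : 'cV[K]_n) (a : instruction K n) : 'cV[K]_n :=
  \col_k (if k == a.1 then \sum_(j < n) a.2 0 j * X j 0 else X k 0).

Definition exec (K : fieldType) (n : nat)
    (P : program K n) (X : 'cV[K]_n) : 'cV[K]_n :=
  foldl (@exec_instr K n) X P.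

Definition computes (K : fieldType) (n : nat)
    (P : program K n) (E : 'cV[K]_n -> 'cV[K]_n) : Prop :=
  forall X : 'cV[K]_n, exec P X = E X.

(* The in-place loop "for i from 1 to n do x_i := \sum_j M_{i,j} x_j"; enum 'I_n
   lists the indices in increasing order. *)
Definition seq_program (K : fieldType) (n : nat) (M : 'M[K]_n) : program K n :=
  [seq (i, row i M) | i <- enum 'I_n].

(* Main.v *)
Require Import Defs.
From HB Require Import structures.
From mathcomp Require Import all_boot all_order all_algebra.

Set Implicit Arguments.
Unset Strict Implicit.
Unset Printing Implicit Defensive.

Import GRing.Theory.
Local Open Scope ring_scope.

(** Every square matrix is a product [A = U *m B] with [U] unit upper
    triangular and [W *m B = V] for some unit lower triangular [W] and upper
    triangular [V]: this is Gaussian elimination in which a zero pivot is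
    repaired by adding a lower row to the pivot row, an operation that goes
    into [U].  The equation [W *m B = V] expresses row [i] of [B *m X] through
    the earlier rows of [B *m X] and the entries [X_j], [j >= i], so the loop
    over [i = 1..n] computes [X := B X] in place.  Row [i] of [U] only involves
    the [X_j] with [j >= i], so the same loop over [i] computes [X := U X],
    and its last step is the identity: [n + (n - 1)] assignments in total. *)

Definition unit_lower (R : nzSemiRingType) (n : nat) (A : 'M[R]_n) : Prop :=
  is_trig_mx A /\ forall i, A i i = 1.

Lemma unit_lower_unitmx (R : comUnitRingType) (n : nat) (A : 'M[R]_n) :
  unit_lower A -> A \in unitmx.
Proof.
by move=> [trigA diagA]; rewrite unitmxE det_trig // big1 ?unitr1.
Qed.

Lemma unit_lower_block (R : nzSemiRingType) (n : nat)
    (c : 'cV[R]_n) (A : 'M[R]_n) :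
  unit_lower A -> unit_lower (block_mx 1%:M 0 c A : 'M_(1 + n)).
Proof.
move=> [trigA diagA]; split.
  by rewrite is_trig_block_mx ?eqxx ?trigA ?mx11_is_trig.
move=> i; case: (split_ordP i) => j ->.
  by rewrite block_mxEul ord1 mxE eqxx.
by rewrite block_mxEdr.
Qed.

(* [u] adds lower rows to the pivot row, [d] holds the elimination multipliers;
   phrased without inverting the pivot, so that a zero column is allowed. *)
Lemma pivot_exists (K : fieldType) (n : nat) (a : 'M[K]_1) (c : 'cV[K]_n) :
  exists (u : 'rV[K]_n) (d : 'cV[K]_n), d *m (a + u *m c) = c.
Proof.
have pivot u : (a + u *m c) 0 0 != 0 ->
    exists (u : 'rV[K]_n) (d : 'cV[K]_n), d *m (a + u *m c) = c.
  move=> nz; exists u, (((a + u *m c) 0 0)^-1 *: c).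
  rewrite [a + u *m c in X in _ *m X]mx11_scalar mul_mx_scalar scalerA.
  by rewrite divff ?scale1r.
have [a0|] := eqVneq (a 0 0) 0; last first.
  by move=> nz; apply: (pivot 0); rewrite mul0mx addr0.
(* With [a] zero, [u] selects a nonzero entry of [c] as the pivot; if [c] vanishes too, [d = 0]
   works. *)
have [->|/cV0Pn [i ci]] := eqVneq c 0.
  by exists 0, 0; rewrite mul0mx.
by apply: (pivot (delta_mx 0 i)); rewrite -rowE !mxE a0 add0r.
Qed.

Lemma ULU_decomposition (K : fieldType) (n : nat) (A : 'M[K]_n) :
  exists U B W V : 'M[K]_n,
    [/\ A = U *m B, W *m B = V, unit_lower U^T, unit_lower W
      & is_trig_mx V^T].
Proof.
elim: n A => [|n IHn].
  move=> A; exists 0, 0, 0, 0; split; do ?[by apply/matrixP=> -[]].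
  - by split=> [|[]//]; apply/is_trig_mxP=> -[].
  - by split=> [|[]//]; apply/is_trig_mxP=> -[].
  - by apply/is_trig_mxP=> -[].
rewrite -[n.+1]/(1 + n)%N => A; rewrite -[A]submxK.
set a := ulsubmx _; set r := ursubmx _; set c := dlsubmx _.
set D := drsubmx _.
have [u [d dac]] := pivot_exists a c.
set a' := a + u *m c in dac; pose r' := r + u *m D.
(* This is the Schur complement left once the repaired pivot row [(a', r')] has cleared [c]. *)
have [U [B [W [V [eqS eqV uU uW tV]]]]] := IHn (D - d *m r').
have Uunit : U \in unitmx by rewrite -unitmx_tr unit_lower_unitmx.
(* [U] has to stand left of the elimination step; pulling it out through that step turns the
   multipliers [d] into [invmx U *m d]. *)
exists (block_mx 1%:M (- (u *m U)) 0 U).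
exists (block_mx a' r' (invmx U *m c) (B + invmx U *m (d *m r'))).
exists (block_mx 1%:M 0 (- (W *m invmx U *m d)) W).
exists (block_mx a' r' 0 V).
have eqc : U *m (invmx U *m c) = c by rewrite mulKVmx.
have eqD : U *m (B + invmx U *m (d *m r')) = D.
  by rewrite mulmxDr -eqS mulKVmx // subrK.
split.
- rewrite mulmx_block !mul1mx !mul0mx !add0r eqc eqD !mulNmx -!mulmxA eqc eqD.
  by rewrite !addrK.
- rewrite mulmx_block !mul1mx !mul0mx !addr0 !mulNmx (mulmxDr W B) eqV -!mulmxA dac.
  by rewrite addNr addrCA addNr addr0.
- by rewrite tr_block_mx trmx1 trmx0; apply: unit_lower_block.
- exact: unit_lower_block.
- by rewrite tr_block_mx trmx0 is_trig_block_mx // eqxx mx11_is_trig.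
Qed.

Lemma exec_cat (K : fieldType) (n : nat) (P Q : program K n) (X : 'cV[K]_n) :
  exec (P ++ Q) X = exec Q (exec P X).
Proof. exact: foldl_cat. Qed.

Lemma size_seq_program (K : fieldType) (n : nat) (M : 'M[K]_n) :
  size (seq_program M) = n.
Proof. by rewrite size_map size_enum_ord. Qed.

(** Loop invariant: instruction [i] reads new values before position [i] and old ones from [i] on.
    Prefixes are treated because the second pass omits its last instruction. *)
Lemma exec_take_seq_program (K : fieldType) (n k : nat) (M : 'M[K]_n)
    (X Y : 'cV[K]_n) :
  (forall i, Y i 0 = \sum_j M i j * (if (j < i)%N then Y j 0 else X j 0)) ->
  (k <= n)%N ->
  exec (take k (seq_program M)) X
    = \col_i (if (i < k)%N then Y i 0 else X i 0).
Proof.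
move=> eqY; elim: k => [_|k IHk ltkn].
  by rewrite take0; apply/colP=> i; rewrite mxE.
pose ik := Ordinal ltkn.
rewrite (take_nth (ik, row ik M)) ?size_seq_program // -cats1 exec_cat.
rewrite (IHk (ltnW ltkn)) (nth_map ik) ?size_enum_ord //.
have -> : nth ik (enum 'I_n) k = ik by apply: val_inj; rewrite /= nth_enum_ord.
apply/colP=> i; rewrite !mxE /=.
have [-> | neq_i] := eqVneq i ik.
  by rewrite ltnSn eqY; apply: eq_bigr => j _; rewrite !mxE.
by rewrite ltnS (leq_eqVlt i k) (negPf (neq_i : (i : nat) != k)).
Qed.

Lemma exec_seq_program (K : fieldType) (n : nat) (M : 'M[K]_n) (X Y : 'cV[K]_n) :
  (forall i, Y i 0 = \sum_j M i j * (if (j < i)%N then Y j 0 else X j 0)) ->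
  exec (seq_program M) X = Y.
Proof.
move=> eqY; rewrite -[seq_program M]take_size size_seq_program.
rewrite (exec_take_seq_program eqY) //.
by apply/colP=> i; rewrite mxE ltn_ord.
Qed.

Lemma exec_seq_program_LU (K : fieldType) (n : nat) (W B V : 'M[K]_n)
    (X : 'cV[K]_n) :
  W *m B = V -> unit_lower W -> is_trig_mx V^T ->
  exec (seq_program (\matrix_(i, j) if (j < i)%N then - W i j else V i j)) X
    = B *m X.
Proof.
move=> eqV [/is_trig_mxP trigW diagW] /is_trig_mxP trigV.
apply: exec_seq_program => i; set Y := B *m X.
have /colP/(_ i) : W *m Y = V *m X by rewrite mulmxA eqV.
rewrite mxE [RHS]mxE (bigD1 i) //= diagW mul1r => /(canRL (addrK _)) ->.
rewrite [X in _ - X]big_mkcond -sumrB; apply: eq_bigr => j _; rewrite mxE.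
(* Termwise, [V] vanishes for [j < i] and [W] for [j > i]; the diagonal term of [W] was split off
   above. *)
case: ltngtP => [ltji | ltij | /val_inj ->].
- have := trigV _ _ ltji; rewrite mxE => ->.
  by rewrite mul0r sub0r mulNr -val_eqE ltn_eqF.
- by rewrite trigW // mul0r if_same subr0.
- by rewrite eqxx subr0.
Qed.

Lemma exec_take_seq_program_unit_upper (K : fieldType) (n : nat) (U : 'M[K]_n)
    (X : 'cV[K]_n) :
  unit_lower U^T -> exec (take n.-1 (seq_program U)) X = U *m X.
Proof.
move=> [/is_trig_mxP trigU diagU].
have upperU (i j : 'I_n) : (j < i)%N -> U i j = 0 by move/trigU; rewrite mxE.
rewrite (@exec_take_seq_program _ _ _ _ _ (U *m X)) ?leq_pred //; last first.
  move=> i; rewrite mxE; apply: eq_bigr => j _.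
  by case: ltnP => // /upperU ->; rewrite !mul0r.
(* Only the last index remains, whose instruction was dropped: there the row of [U] is that of the
   identity. *)
apply/colP=> i; rewrite mxE; case: ltnP => // le_i.
rewrite mxE (bigD1 i) //= big1 => [|j neq_ji].
  by have := diagU i; rewrite mxE => ->; rewrite mul1r addr0.
rewrite upperU ?mul0r // ltn_neqAle neq_ji.
by rewrite (leq_trans _ le_i) // -ltnS (ltn_predK (ltn_ord i)).
Qed.

Theorem theorem1 (K : fieldType) (n : nat) (hn : (0 < n)%N)
    (E : {linear 'cV[K]_n -> 'cV[K]_n}) :
  exists (P : program K n) (M : 'M[K]_n),
    [/\ (size P <= 2 * n - 1)%N,
        computes P E
      & take n P = seq_program M].
Proof.
pose A : 'M[K]_n := \matrix_(i, j) E (delta_mx j 0) i 0.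
have eqE X : E X = A *m X.
  rewrite {1}(matrix_sum_delta X) linear_sum; apply/colP=> i.
  rewrite summxE mxE; apply: eq_bigr => j _.
  by rewrite big_ord1 linearZ !mxE mulrC.
have [U [B [W [V [eqA eqV uU uW tV]]]]] := ULU_decomposition A.
pose M := \matrix_(i, j) if (j < i)%N then - W i j else V i j.
exists (seq_program M ++ take n.-1 (seq_program U)), M; split.
- rewrite size_cat size_take_min !size_seq_program (minn_idPl (leq_pred n)).
  by rewrite -subn1 addnBA // mul2n addnn.
- move=> X; rewrite exec_cat (exec_seq_program_LU _ eqV) //.
  by rewrite exec_take_seq_program_unit_upper // mulmxA -eqA eqE.
- by rewrite take_size_cat // size_seq_program.
Qed.
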